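(* Each Banach Lie algebra $\mathcal{L}\in\mathbf{Sem}(P_{\mathfrak{S}^{\max}})$ has the largest solvable (respectively, commutative) Lie ideal, that is, a closed solvable (respectively, commutative) Lie ideal that contains all solvable (respectively, commutative) Lie ideals of $\mathcal{L}$.
   Context: A Banach Lie algebra is a complex Lie algebra $\mathcal{L}$ which is a Banach space in some norm such that, for some constant $t_{\mathcal{L}}>0$, $\|[a,b]\|\leq t_{\mathcal{L}}\|a\|\|b\|$ for all $a,b\in\mathcal{L}$. $P_{\mathfrak{S}^{\max}}(\mathcal{L})$ is the intersection of all maximal proper closed Lie subalgebras of finite codimension in $\mathcal{L}$ (and is $\mathcal{L}$ if there are none). $\mathbf{Sem}(P_{\mathfrak{S}^{\max}})$ is the class of Banach Lie algebras $\mathcal{L}$ with $P_{\mathfrak{S}^{\max}}(\mathcal{L})=\{0\}$ (Frattini-free Banach Lie algebras). Put $\mathcal{L}_{[0]}=\mathcal{L}$, $\mathcal{L}_{[n+1]}=\overline{[\mathcal{L}_{[n]},\mathcal{L}_{[n]}]}$; $\mathcal{L}$ is solvable if $\mathcal{L}_{[n]}=\{0\}$ for some $n$. *)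

(* Defs.v *)
From HB Require Import structures.
From mathcomp Require Import all_boot all_order all_algebra.
From mathcomp Require Import all_classical all_reals all_analysis.
From mathcomp.real_closed Require Export complex.
Set Implicit Arguments.
Unset Strict Implicit.
Unset Printing Implicit Defensive.
Import Order.TTheory GRing.Theory Num.Theory numFieldNormedType.Exports.
Local Open Scope classical_set_scope.
Local Open Scope ring_scope.

(* In normedModType R[i] the norm takes its values in the nonnegative reals of
   R[i], and 0 < t in R[i] means that t is real and positive. *)
HB.mixin Record CompleteNormedModule_isBanachLie (R : realType) L
    of CompleteNormedModule R[i] L := {
  lie_bracket : {bilinear L -> L -> L};
  lie_bracketxx : forall a : L, lie_bracket a a = 0;
  lie_jacobi : forall a b c : L,
    lie_bracket a (lie_bracket b c) + lie_bracket b (lie_bracket c a)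
      + lie_bracket c (lie_bracket a b) = 0;
  lie_bracket_bounded : exists2 t : R[i], 0 < t &
    forall a b : L, `|lie_bracket a b| <= t * `|a| * `|b|
}.

#[short(type="banachLieType")]
HB.structure Definition BanachLie (R : realType) :=
  {L of CompleteNormedModule_isBanachLie R L & CompleteNormedModule R[i] L}.

Section BanachLieDefs.
Context {R : realType} {L : banachLieType R}.
Implicit Types (a b : L) (A B M N I J : set L).

Definition lie_commutators A B : set L :=
  [set lie_bracket a b | a in A & b in B].

Definition linear_subspace A : Prop := GRing.submod_closed [in A].

Definition linear_span A : set L := smallest linear_subspace A.

Definition lie_subalgebra M : Prop :=
  linear_subspace M /\ lie_commutators M M `<=` M.

(* Not required to be closed. *)
Definition lie_ideal J : Prop :=
  linear_subspace J /\ lie_commutators setT J `<=` J.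

(* The quotient L / A is spanned by the classes of finitely many v i. *)
Definition finite_codim A : Prop :=
  exists n (v : 'I_n -> L), forall a,
    exists c : 'I_n -> R[i], A (a - \sum_(i < n) c i *: v i).

Definition proper_closed_subalgebra M : Prop :=
  [/\ lie_subalgebra M, closed M & M <> setT].

(* Maximality among all proper closed subalgebras; these automatically have
   finite codimension when they contain M. *)
Definition maximal_closed_subalgebra M : Prop :=
  proper_closed_subalgebra M /\
  forall N, proper_closed_subalgebra N -> M `<=` N -> N = M.

Definition lie_commutative J : Prop :=
  forall a b, J a -> J b -> lie_bracket a b = 0.

(* The closures are taken in L. For J not closed, only term 0 differs from
   the series of the closure of J, and term n is zero iff term n of the purely
   algebraic derived series of J is. *)
Fixpoint derived_series J (n : nat) : set L :=
  if n is n'.+1 then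
    closure (linear_span
      (lie_commutators (derived_series J n') (derived_series J n')))
  else J.

Definition lie_solvable J : Prop := exists n, derived_series J n = [set 0].

Definition largest_ideal (P : set L -> Prop) J : Prop :=
  [/\ closed J, lie_ideal J, P J &
      forall I, lie_ideal I -> P I -> I `<=` J].

End BanachLieDefs.

(* The intersection of an empty family is the whole of L. *)
Definition P_Smax (R : realType) (L : banachLieType R) : set L :=
  \bigcap_(M in [set M : set L | maximal_closed_subalgebra M /\
                                 finite_codim M]) M.
Arguments P_Smax {R} L.

Definition Sem_P_Smax (R : realType) (L : banachLieType R) : Prop :=
  P_Smax L = [set 0].
Arguments Sem_P_Smax {R} L.

(* Main.v *)
Require Import Defs.
From mathcomp Require Import all_boot all_order all_algebra.
From mathcomp Require Import all_classical all_reals all_analysis.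
Set Implicit Arguments.
Unset Strict Implicit.
Unset Printing Implicit Defensive.
Import Order.TTheory GRing.Theory Num.Theory numFieldNormedType.Exports.
Local Open Scope classical_set_scope.
Local Open Scope ring_scope.

(** Let M be a maximal closed subalgebra of finite codimension. Every subspace
    containing M is closed, by completeness of the complex numbers, so a
    subalgebra containing M is M or L; in particular L = M + K for each ideal K
    not contained in M.

    If a and b belong to commutative ideals I and J, take K = I `&` J. Either K
    is contained in M, or L = M + K; as K centralizes I and J, in both cases
    [a, b] is in M ([commutative_ideals_bracket]). As the intersection of all
    these M is 0, the commutative ideals commute with one another, and their
    union, which is stable under inner derivations, lies in a closed
    commutative ideal N ([commuting_ideal_hull]).

    If I is a solvable ideal, then [L, I] is commutative. To see it, let A be the
    last term of the derived series of I that is not contained in M (if I itself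
    is contained in M there is nothing to prove). Then L = M + A and [A, A] is
    contained in M, so L / M is an irreducible finite-dimensional M-module, on
    which I `&` M acts as a solvable ideal, since A `&` M acts by 0. By the
    argument of Lie's theorem, [M, I `&` M] acts by 0
    ([irreducible_solvable_ideal]). Modulo A, elements of [L, I] are in
    [M, I `&` M], so their brackets are in M ([solvable_ideal_bracket]), hence
    vanish.

    Thus [L, I] is contained in N for every solvable ideal I. Conversely the
    closed ideal of all x with [L, x] contained in N has its second derived term
    equal to 0, so it is the largest solvable ideal. *)

(** * Solvable ideals of irreducible Lie algebras of matrices *)

Section MatrixLie.
Variables (C : numClosedFieldType) (n : nat).
Implicit Types (X Y Z T : 'M[C]_n.+1) (w : 'rV[C]_n.+1).
Implicit Types (G J : set 'M[C]_n.+1) (W : set 'rV[C]_n.+1).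

(** The commutator of two matrices. *)
Definition mx_bracket X Y : 'M[C]_n.+1 := X *m Y - Y *m X.

(** Irreducibility of a set of matrices acting on row vectors on the right.
    Invariant subspaces are predicates on row vectors, so that they can be
    pulled back along any linear map. *)
Definition mx_irreducible G : Prop := forall W,
  GRing.submod_closed [in W] ->
  (forall Y w, G Y -> W w -> W (w *m Y)) ->
  (exists2 w, W w & w != 0) -> forall w, W w.

Lemma mx_bracketC X Y : mx_bracket Y X = - mx_bracket X Y.
Proof. by rewrite /mx_bracket opprB. Qed.

Lemma mxtrace_bracket X Y : \tr (mx_bracket X Y) = 0.
Proof. by rewrite /mx_bracket raddfB /= mxtrace_mulC subrr. Qed.

(** When T commutes with [T, Y], the generalized kernel of T is stable under Y,
    at the price of one more power of T. *)
Lemma gen_kernel_stable T Y w k : comm_mx T (mx_bracket T Y) ->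
  w *m T ^+ k = 0 -> w *m Y *m T ^+ k.+1 = 0.
Proof.
move=> cT; elim: k w => [|k IH] w.
  by rewrite expr0 mulmx1 => ->; rewrite !mul0mx.
move=> wT.
have TY : Y *m T = T *m Y - mx_bracket T Y by rewrite /mx_bracket opprB addrC subrK.
have cTk : comm_mx (mx_bracket T Y) (T ^+ k.+1) by exact: (commrX k.+1 (comm_mx_sym cT)).
(* The induction hypothesis applies to w *m T, which T ^+ k kills. *)
have IHw : w *m T *m Y *m T ^+ k.+1 = 0.
  by apply: IH; rewrite -mulmxA -[T *m _]/(T * _) -exprS.
rewrite exprS -[T * _]/(T *m _) mulmxA -(mulmxA w) TY mulmxBr mulmxBl.
by rewrite mulmxA IHw -mulmxA cTk mulmxA wT mul0mx subr0.
Qed.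

Lemma mxtrace_unique_eigenvalue Z mu :
  (forall nu, eigenvalue Z nu -> nu = mu) -> \tr Z = mu *+ n.+1.
Proof.
move=> Zmu; have [r] := closed_field_poly_normal (char_poly Z).
rewrite (monicP (char_poly_monic Z)) scale1r => Er.
have szr : size r = n.+1.
  by apply: succn_inj; rewrite -(size_char_poly Z) Er size_prod_XsubC.
have sum_r := @coefPn_prod_XsubC _ r; rewrite szr in sum_r.
have := @char_poly_trace _ _ Z isT; rewrite Er sum_r // => /oppr_inj <-.
rewrite (eq_big_seq (fun=> mu)) => [|z rz].
  by rewrite big_const_seq count_predT szr iter_addr_0.
by apply: Zmu; rewrite eigenvalue_root_char Er root_prod_XsubC.
Qed.

(** The conclusion is local nilpotency: the generalized eigenspace of Z for some
    eigenvalue mu is invariant, hence is everything, so mu is the only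
    eigenvalue of Z, and it vanishes because the trace does. *)
Lemma irreducible_trace0_nilpotent G Z : mx_irreducible G ->
  (forall Y, G Y -> comm_mx Z (mx_bracket Z Y)) -> \tr Z = 0 ->
  forall w, exists k, w *m Z ^+ k = 0.
Proof.
move=> irr cZ trZ.
have [mu /eigenvalueP[v /eqP vZ v0]] := @eigenvalue_closed C n.+1 Z isT.
have brE Y : mx_bracket (Z - mu%:M) Y = mx_bracket Z Y.
  by rewrite /mx_bracket mulmxBl mulmxBr -scalar_mxC opprB subrKA.
(* The generalized eigenspace of mu is invariant, so it is everything. *)
have full : forall w, exists k, w *m (Z - mu%:M) ^+ k = 0.
  apply: (irr [set w | exists k, w *m (Z - mu%:M) ^+ k = 0]).
  - split=> [|a u w]; rewrite !in_setE /=; first by exists 0%N; rewrite mul0mx.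
    move=> [k uk] [l wl]; exists (k + l)%N.
    rewrite mulmxDl -scalemxAl {1}exprD addnC exprD.
    by rewrite -![_ ^+ _ * _]/(_ *m _) !mulmxA uk wl !mul0mx scaler0 addr0.
  - move=> Y w GY [k wk]; exists k.+1; apply: gen_kernel_stable => //.
    rewrite brE; apply/comm_mx_sym/comm_mxB; first exact/comm_mx_sym/cZ.
    exact: comm_mx_scalar.
  - exists v => //; exists 1%N; rewrite expr1 mulmxBr mul_mx_scalar.
    by rewrite (eqP vZ) subrr.
have trmu : \tr Z = mu *+ n.+1.
  apply: mxtrace_unique_eigenvalue => nu /eigenvalueP[u /eqP uZ u0].
  have [k uk] := full u.
  have E : u *m (Z - mu%:M) ^+ k = (nu - mu) ^+ k *: u.
    elim: k {uk} => [|k IH]; first by rewrite !expr0 mulmx1 scale1r.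
    rewrite exprSr -[_ * (_ - _)]/(_ *m _) mulmxA IH -scalemxAl mulmxBr.
    by rewrite mul_mx_scalar (eqP uZ) -scalerBl scalerA exprSr.
  move: uk; rewrite E => /eqP; rewrite scaler_eq0 (negPf u0) orbF.
  by rewrite expf_eq0 subr_eq0 => /andP[_ /eqP].
have mu0 : mu = 0.
  by move: trmu; rewrite trZ => /eqP; rewrite eq_sym mulrn_eq0 => /eqP.
by move=> w; have := full w; rewrite mu0 raddf0 subr0.
Qed.

(** A nonzero D-stable subspace U of minimal rank lies in the common kernel: for
    Z in D, the nilpotency of Z gives U a nonzero intersection with the kernel
    of Z, which is D-stable by commutation and so, by minimality, is U itself. *)
Lemma common_kernel_vector (D : set 'M[C]_n.+1) :
  (forall Z Z', D Z -> D Z' -> comm_mx Z Z') ->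
  (forall Z, D Z -> forall w, exists k, w *m Z ^+ k = 0) ->
  exists2 w : 'rV[C]_n.+1, w != 0 & forall Z, D Z -> w *m Z = 0.
Proof.
move=> cD nilD.
pose P r := `[< exists U : 'M[C]_n.+1,
  [/\ \rank U = r, U != 0 & forall Z, D Z -> stablemx U Z] >].
have exP : exists r, P r.
  exists n.+1; apply/asboolP; exists 1%:M; split; first exact: mxrank1.
    by rewrite -mxrank_eq0 mxrank1.
  by move=> Z _; exact: stableCmx.
have [r /asboolP[U [rkU U0 stU]] minr] := ex_minnP exP.
exists (nz_row U); first by rewrite nz_row_eq0.
move=> Z DZ; apply/sub_kermxP; apply: submx_trans (nz_row_sub U) _.
have [u uU] : exists2 u : 'rV_n.+1, (u <= U :&: kermx Z)%MS & u != 0.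
  have [k uk] := nilD Z DZ (nz_row U).
  have ex0 : exists k, nz_row U *m Z ^+ k == 0 by exists k; apply/eqP.
  have [[|l] /eqP ul minl] := ex_minnP ex0.
    by move: ul; rewrite expr0 mulmx1 => /eqP; rewrite nz_row_eq0 (negPf U0).
  exists (nz_row U *m Z ^+ l); last first.
    by apply/negP => /minl; rewrite ltnn.
  rewrite sub_capmx; apply/andP; split; last first.
    by apply/sub_kermxP; rewrite -mulmxA -[Z ^+ l *m Z]/(Z ^+ l * Z) -exprSr.
  elim: l {ul minl} => [|l IH]; first by rewrite expr0 mulmx1 nz_row_sub.
  rewrite exprSr -[Z ^+ l * Z]/(Z ^+ l *m Z) mulmxA.
  exact: submx_trans (submxMr Z IH) (stU Z DZ).
move=> u0; set V := (U :&: kermx Z)%MS in uU.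
have V0 : V != 0 by apply: contraNneq u0 => V0; rewrite V0 submx0 in uU.
have stV X : D X -> stablemx V X.
  move=> DX; rewrite sub_capmx.
  rewrite (submx_trans (submxMr X (capmxSl _ _)) (stU X DX)) /=.
  apply: submx_trans (submxMr X (capmxSr _ _)) _.
  exact/comm_mx_stable_ker/cD.
have rV : (r <= \rank V)%N by apply: minr; apply/asboolP; exists V.
have /eqmxP/eqmx_sym UV : (V == U)%MS.
  by rewrite -(mxrank_leqif_eq (capmxSl U (kermx Z))) eqn_leq mxrankS ?capmxSl //= rkU.
by rewrite UV capmxSr.
Qed.

(** Since D is stable under brackets with G, its common kernel is
    G-invariant. *)
Lemma irreducible_nilpotent_ideal G (D : set 'M[C]_n.+1) : mx_irreducible G ->
  (forall Z Z', D Z -> D Z' -> comm_mx Z Z') ->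
  (forall Z, D Z -> forall w, exists k, w *m Z ^+ k = 0) ->
  (forall Z Y, D Z -> G Y -> D (mx_bracket Z Y)) ->
  forall Z, D Z -> Z = 0.
Proof.
move=> irr cD nilD idD Z DZ.
have full : forall w Z, D Z -> w *m Z = 0.
  apply: (irr [set w | forall Z, D Z -> w *m Z = 0]).
  - split=> [|a u w]; rewrite !in_setE /=; first by move=> *; rewrite mul0mx.
    by move=> Du Dw X DX; rewrite mulmxDl -scalemxAl Du ?Dw // scaler0 addr0.
  - move=> Y w GY Dw X DX; have := Dw _ (idD X Y DX GY).
    by rewrite /mx_bracket mulmxBr !mulmxA (Dw X DX) mul0mx sub0r => /eqP; rewrite oppr_eq0 => /eqP.
  - by have [w w0 Dw] := common_kernel_vector cD nilD; exists w.
by apply/row_matrixP => i; rewrite rowE full // row0.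
Qed.

(** J is a chain of ideals of the Lie algebra G with [J_k, J_k] in J_(k+1) and
    J_m = 0: this is the consequence of Lie's theorem that a solvable ideal of
    an irreducible Lie algebra is central. *)
Lemma irreducible_solvable_ideal G (J : nat -> set 'M[C]_n.+1) m :
  mx_irreducible G -> (forall k, J k `<=` G) ->
  (forall k X Y, J k X -> G Y -> J k (mx_bracket X Y)) ->
  (forall k X Y, J k X -> J k Y -> J k.+1 (mx_bracket X Y)) ->
  J m `<=` [set 0] ->
  forall X Y, J 0%N X -> G Y -> mx_bracket X Y = 0.
Proof.
move=> irr; elim: m J => [|m IH] J JG idJ solJ Jm X Y JX GY.
  by rewrite (Jm X JX) /mx_bracket mul0mx mulmx0 subrr.
(* By induction J_1 is central in G. *)
have J1 : forall X Y, J 1%N X -> G Y -> mx_bracket X Y = 0.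
  exact: (IH (J \o succn) (fun k => JG k.+1) (fun k => idJ k.+1)
    (fun k => solJ k.+1) Jm).
have J1c X' Y' : J 1%N X' -> G Y' -> comm_mx X' Y'.
  by move=> /J1 /[apply] /subr0_eq.
(* Brackets in J_0 lie in J_1 and have trace 0, hence vanish. *)
have J0c X' Y' : J 0%N X' -> J 0%N Y' -> comm_mx X' Y'.
  move=> JX' JY'; apply: subr0_eq.
  apply: (irreducible_nilpotent_ideal irr (D := [set Z | J 1%N Z /\ \tr Z = 0])).
  - by move=> Z Z' [JZ _] [JZ' _]; apply: J1c => //; exact: (JG 1%N).
  - move=> Z [JZ trZ]; apply: irreducible_trace0_nilpotent irr _ trZ.
    move=> T GT; apply: J1c => //; apply: (JG 1%N); exact: idJ.
  - by move=> Z T [JZ _] GT; split; [exact: idJ|exact: mxtrace_bracket].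
  - by split; [exact: solJ|exact: mxtrace_bracket].
(* J_0 being commutative, the same holds for the brackets of J_0 with G. *)
apply: (irreducible_nilpotent_ideal irr (D := [set Z | J 0%N Z /\ \tr Z = 0])).
- by move=> Z Z' [JZ _] [JZ' _]; apply: J0c.
- move=> Z [JZ trZ]; apply: irreducible_trace0_nilpotent irr _ trZ.
  by move=> T GT; apply: J0c => //; exact: idJ.
- by move=> Z T [JZ _] GT; split; [exact: idJ|exact: mxtrace_bracket].
- by split; [exact: idJ|exact: mxtrace_bracket].
Qed.

End MatrixLie.

(** * Completeness of the complex numbers *)

Section ComplexLimits.
Variables (R : realType) (T : Type) (F : set_system T).
Context {FF : ProperFilter F}.
Local Open Scope complex_scope.

Lemma real_cvg_of_cauchy (g : T -> R) :
  (forall e : R, 0 < e -> exists c, \forall w \near F, `|c - g w| < e) ->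
  exists l : R, g w @[w --> F] --> l.
Proof.
move=> cauchyg; suff: cvg (g w @[w --> F]) by move/cvg_ex.
apply: cauchy_cvg; apply: cauchy_exP => e e0.
have [c Fc] := cauchyg e e0; exists c; near=> w; rewrite /ball /=; near: w.
exact: Fc.
Unshelve. all: by end_near. Qed.

Lemma normc_ge_Im (x : R[i]) : `|complex.Im x|%:C <= `|x|.
Proof. by case: x => a b; simpc; rewrite -sqrtr_sqr ler_wsqrtr // lerDr sqr_ge0. Qed.

Lemma normc_le_ReD_Im (x : R[i]) :
  `|x| <= (`|complex.Re x| + `|complex.Im x|)%:C.
Proof.
rewrite normc_def lecR -[leRHS]ger0_norm ?addr_ge0 // -sqrtr_sqr ler_wsqrtr //.
rewrite sqrrD !real_normK ?num_real // addrAC lerDl.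
by rewrite mulrn_wge0 // mulr_ge0.
Qed.

(** The Cauchy condition is only required for real positive radii. *)
Lemma complex_cvg_of_cauchy (f : T -> R[i]) :
  (forall e : R, 0 < e -> exists c, \forall w \near F, `|c - f w| < e%:C) ->
  exists l : (R[i] : numFieldType), f w @[w --> F] --> l.
Proof.
move=> cauchyf.
have [a ReF] : exists a : R, complex.Re (f w) @[w --> F] --> a.
  apply: real_cvg_of_cauchy => e /cauchyf[c Fc]; exists (complex.Re c).
  near=> w; rewrite -ltcR -raddfB; apply: le_lt_trans (normc_ge_Re _) _.
  by near: w; exact: Fc.
have [b ImF] : exists a : R, complex.Im (f w) @[w --> F] --> a.
  apply: real_cvg_of_cauchy => e /cauchyf[c Fc]; exists (complex.Im c).
  near=> w; rewrite -ltcR -raddfB; apply: le_lt_trans (normc_ge_Im _) _.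
  by near: w; exact: Fc.
exists (a +i* b); apply/(@cvgrPdist_lt R[i] R[i]^o) => e e0.
have Ee : e = (complex.Re e)%:C by rewrite RRe_real // gtr0_real.
have e20 : 0 < complex.Re e / 2 by rewrite divr_gt0 // -ltcR -Ee.
near=> w; apply: le_lt_trans (normc_le_ReD_Im _) _.
rewrite Ee ltcR [ltRHS]splitr !raddfB /=; apply: ltrD; near: w.
  exact: (cvgrPdist_lt _ _).1 ReF _ e20.
exact: (cvgrPdist_lt _ _).1 ImF _ e20.
Unshelve. all: by end_near. Qed.
End ComplexLimits.

(** * Subspaces, brackets and centralizers *)

Section BanachLie.
Context {R : realType} {L : banachLieType R}.
Implicit Types (a b x y z : L) (A B C I J M N W : set L).

Local Notation "⟨ a , b ⟩" := (lie_bracket a b)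
  (at level 0, a, b at level 99, format "⟨ a ,  b ⟩").

Section Subspace.
Variables (W : set L) (hW : linear_subspace W).

Lemma subspace0 : W 0.
Proof. by case: hW => + _; rewrite in_setE. Qed.

Lemma subspaceZD c a b : W a -> W b -> W (c *: a + b).
Proof. by case: hW => _ + Wa Wb => /(_ c a b); rewrite !in_setE; apply. Qed.

Lemma subspaceD a b : W a -> W b -> W (a + b).
Proof. by move=> Wa Wb; rewrite -(scale1r a); exact: subspaceZD. Qed.

Lemma subspaceZ c a : W a -> W (c *: a).
Proof. by move=> Wa; rewrite -[_ *: _]addr0; apply: subspaceZD => //; exact: subspace0. Qed.

Lemma subspaceN a : W a -> W (- a).
Proof. by rewrite -scaleN1r; exact: subspaceZ. Qed.

Lemma subspaceB a b : W a -> W b -> W (a - b).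
Proof. by move=> Wa /subspaceN; exact: subspaceD. Qed.
End Subspace.

Lemma subspaceP W : W 0 -> (forall c a b, W a -> W b -> W (c *: a + b)) ->
  linear_subspace W.
Proof.
by move=> W0 WD; split=> [|c a b]; rewrite !in_setE //; exact: WD.
Qed.

Lemma subspaceI A B : linear_subspace A -> linear_subspace B ->
  linear_subspace (A `&` B).
Proof.
move=> hA hB; apply: subspaceP; first by split; exact: subspace0.
by move=> c a b [Aa Ba] [Ab Bb]; split; exact: subspaceZD.
Qed.

(** The sum A + B of two sets of vectors. *)
Definition subspace_add A B : set L := [set x | exists2 a, A a & B (x - a)].

Lemma subspace_add_sub A B : linear_subspace A -> linear_subspace B ->
  linear_subspace (subspace_add A B).
Proof.
move=> hA hB; apply: subspaceP.
  by exists 0; [exact: subspace0|rewrite subr0; exact: subspace0].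
move=> c x y [a Aa Bx] [b Ab By]; exists (c *: a + b); first exact: subspaceZD.
by rewrite opprD addrACA -scalerBr; exact: subspaceZD.
Qed.

Lemma subset_addl A B : linear_subspace B -> A `<=` subspace_add A B.
Proof. by move=> hB a Aa; exists a; rewrite // subrr; exact: subspace0. Qed.

Lemma subset_addr A B : linear_subspace A -> B `<=` subspace_add A B.
Proof. by move=> hA a Aa; exists 0; rewrite ?subr0 //; exact: subspace0. Qed.

Lemma linear_span_sub A : linear_subspace (linear_span A).
Proof.
apply: subspaceP => [B [hB _]|c a b Aa Ab B [hB AB]]; first exact: subspace0.
by apply: subspaceZD => //; [apply: Aa|apply: Ab].
Qed.

Lemma lie_bracketC a b : ⟨a, b⟩ = - ⟨b, a⟩.
Proof.
apply/eqP; rewrite -addr_eq0; apply/eqP.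
have := lie_bracketxx (a + b).
by rewrite linearDl !linearDr /= !lie_bracketxx add0r addr0 addrC.
Qed.

Lemma lie_bracketBB a b a' b' :
  ⟨a, b⟩ - ⟨a', b'⟩ = ⟨a, b - b'⟩ - ⟨b', a - a'⟩.
Proof.
rewrite !linearBr /= (lie_bracketC b' a) (lie_bracketC b' a') opprB opprK.
by rewrite [X in _ = _ + X]addrC addrA subrK.
Qed.

(** Inner derivations are derivations. *)
Lemma lie_jacobi_derivation x y z : ⟨x, ⟨y, z⟩⟩ = ⟨⟨x, y⟩, z⟩ + ⟨y, ⟨x, z⟩⟩.
Proof.
have /eqP := lie_jacobi x y z; rewrite -addrA addr_eq0 => /eqP ->.
rewrite opprD addrC; congr (_ + _); first by rewrite -lie_bracketC.
by rewrite (lie_bracketC z x) linearNr opprK.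
Qed.

Lemma lie_subalgebra_bracket M a b :
  lie_subalgebra M -> M a -> M b -> M ⟨a, b⟩.
Proof. by move=> [_ brM] Ma Mb; apply: brM; exists a => //; exists b. Qed.

Lemma lie_bracket_continuous y : continuous (lie_bracket y : L -> L).
Proof.
apply: bounded_linear_continuous; apply/linear_boundedP.
have [t t0 brt] := @lie_bracket_bounded R L.
near=> r.
have tr : t * `|y| <= r.
  by near: r; apply: nbhs_pinfty_ge; rewrite realM // gtr0_real.
by move=> x; apply: le_trans (brt y x) _; exact: ler_wpM2r.
Unshelve. all: by end_near. Qed.

Lemma closed_bracket_preimage y A : closed A -> closed [set x | A ⟨y, x⟩].
Proof. by move=> cA; apply: (preimage_closed _ cA) => x _; exact: lie_bracket_continuous. Qed.

(** Stability under all inner derivations, without linearity; ideals are the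
    ad-stable subspaces. *)
Definition ad_stable A := forall y a, A a -> A ⟨y, a⟩.

Lemma lie_idealP J : lie_ideal J <-> linear_subspace J /\ ad_stable J.
Proof.
split=> -[hJ idJ]; split=> //; first by move=> y a Ja; apply: idJ; exists y => //; exists a.
by move=> _ [y _ [a Ja <-]]; exact: idJ.
Qed.

(** The elements commuting with all of A. *)
Definition lie_centralizer A : set L := [set x | forall c, A c -> ⟨c, x⟩ = 0].

Lemma closed_lie_centralizer A : closed (lie_centralizer A).
Proof.
rewrite (_ : lie_centralizer A = \bigcap_(c in A) [set x | [set 0] ⟨c, x⟩]) //.
apply: closed_bigI => c _; apply: closed_bracket_preimage.
exact/accessible_closed_set1/hausdorff_accessible/norm_hausdorff.
Qed.

Lemma lie_centralizer_sub A : linear_subspace (lie_centralizer A).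
Proof.
apply: subspaceP => [c _|c a b Aa Ab d Ad]; first by rewrite linear0r.
by rewrite linearDr linearZr /= Aa ?Ab // scaler0 addr0.
Qed.

Lemma lie_centralizer_ideal A : ad_stable A -> lie_ideal (lie_centralizer A).
Proof.
move=> adA; apply/lie_idealP; split; first exact: lie_centralizer_sub.
move=> y x Ax c Ac; rewrite lie_jacobi_derivation (Ax c Ac) linear0r addr0.
by rewrite (lie_bracketC c) linearNl (Ax _ (adA y c Ac)) oppr0.
Qed.

(** N is the intersection of the centralizer of C with its double
    centralizer. *)
Lemma commuting_ideal_hull C : ad_stable C ->
  (forall a b, C a -> C b -> ⟨a, b⟩ = 0) ->
  exists N, [/\ closed N, lie_ideal N, lie_commutative N & C `<=` N].
Proof.
move=> adC commC; pose Z := lie_centralizer C.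
have idZ : lie_ideal Z by exact: lie_centralizer_ideal.
have idZZ : lie_ideal (lie_centralizer Z).
  by apply: lie_centralizer_ideal; case/lie_idealP: idZ.
exists (Z `&` lie_centralizer Z); split.
- by apply: closedI; exact: closed_lie_centralizer.
- apply/lie_idealP; case/lie_idealP: idZ => sZ adZ.
  case/lie_idealP: idZZ => sZZ adZZ; split; first exact: subspaceI.
  by move=> y a [Za ZZa]; split; [exact: adZ|exact: adZZ].
- by move=> a b [Za _] [_ ZZb]; exact: ZZb.
- move=> a Ca; split=> [c Cc|z Zz]; first exact: commC.
  by rewrite lie_bracketC (Zz _ Ca) oppr0.
Qed.

(** * Closed subspaces of finite codimension *)

(** If v is not in W, the coefficient of v on W + Cv is a bounded functional.
    Along vectors of W + Cv tending to x it is therefore Cauchy, and its limit c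
    satisfies x - cv in W. *)
Lemma closed_add_line W v : linear_subspace W -> closed W ->
  closed (subspace_add [set c *: v | c in setT] W).
Proof.
move=> sW cW.
have [Wv|Wv] := pselect (W v).
  rewrite (_ : subspace_add _ _ = W) //; apply/seteqP; split=> x.
    move=> [_ [c _ <-] Wx]; rewrite -(subrK (c *: v) x).
    by apply: subspaceD => //; exact: subspaceZ.
  by move=> Wx; exists 0; rewrite ?subr0 //; exists 0; rewrite ?scale0r.
have [e e0 We] : exists2 e : R[i], 0 < e & forall x, `|v - x| < e -> ~ W x.
  have /nbhs_normP[e e0 We] : nbhs v (~` W).
    by apply: open_nbhs_nbhs; split => //; exact: closed_openC.
  by exists e.
(* e bounds from below the distance from v to W. *)
have bound x c : W (x - c *: v) -> `|c| <= `|x| / e.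
  move=> Wx; have [->|c0] := eqVneq c 0; first by rewrite normr0 divr_ge0 // ltW.
  rewrite ler_pdivlMr // real_leNgt ?realM ?normr_real ?gtr0_real //.
  apply/negP => xc; apply: (We (v - c^-1 *: x)).
    rewrite opprB addrC subrK normrZ normfV mulrC ltr_pdivrMr ?normr_gt0 //.
    by rewrite mulrC.
  rewrite -[v](scalerK c0) -scalerBr -opprB.
  by apply: subspaceZ => //; exact: subspaceN.
move=> x clx; set X := subspace_add _ _ in clx.
(* phi w is the coefficient of v in w. *)
have [phi phiP] : {phi : L -> R[i] & forall w, X w -> W (w - phi w *: v)}.
  apply: (@choice _ _ (fun w c => X w -> W (w - c *: v))) => w.
  have [[_ [c _ <-] Ww]|nX] := pselect (X w); first by exists c.
  by exists 0.
have FX : ProperFilter (within X (nbhs x)) by exact: within_nbhs_proper.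
have [c phic] : exists c : (R[i] : numFieldType), phi w @[w --> within X (nbhs x)] --> c.
  apply: complex_cvg_of_cauchy => d d0.
  have d0' : 0 < d%:C%C * e / 2 :> R[i] by rewrite divr_gt0 // mulr_gt0 // ltcR.
  have [w Xw wx] : exists2 w, X w & `|x - w| < d%:C%C * e / 2.
    have [w [Xw wx]] := clx _ (nbhsx_ballx x _ d0').
    by exists w => //; move: wx; rewrite -ball_normE.
  exists (phi w); near=> u.
  have Xu : X u by near: u; exact: withinT.
  have ux : `|x - u| < d%:C%C * e / 2.
    near: u; apply: cvg_within; apply/nbhs_normP.
    by exists (d%:C%C * e / 2).
  have /bound : W ((w - u) - (phi w - phi u) *: v).
    rewrite scalerBl opprB addrACA [- u + _]addrC addrACA -[_ - u]opprB.
    exact: subspaceB (phiP w Xw) (phiP u Xu).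
  move=> /le_lt_trans; apply; rewrite ltr_pdivrMr // [ltRHS]splitr.
  rewrite -(subrK x w) -addrA; apply: le_lt_trans (ler_normD _ _) _.
  by apply: ltrD => //; rewrite distrC.
exists (c *: v); first by exists c.
apply: (closed_cvg W cW _ _ (_ : w - phi w *: v @[w --> within X (nbhs x)] --> _)).
  by near=> w; apply: phiP; near: w; exact: withinT.
by apply: cvgB; [exact: cvg_within|exact: cvgZr_tmp].
Unshelve. all: by end_near. Qed.

(** The classes of the v i span L / W. *)
Definition spans_mod W n (v : 'I_n -> L) : Prop :=
  forall a, exists c : 'I_n -> R[i], W (a - \sum_(i < n) c i *: v i).

(** A vector with a nonzero coefficient in a relation modulo W is redundant. *)
Lemma spans_mod_drop W n (v : 'I_n.+1 -> L) (c : 'I_n.+1 -> R[i]) j :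
  linear_subspace W -> spans_mod W v -> W (\sum_(i < n.+1) c i *: v i) ->
  c j != 0 -> spans_mod W (fun i => v (lift j i)).
Proof.
move=> sW spv Wc cj a; have [d Wd] := spv a; pose t := d j / c j.
exists (fun i => d (lift j i) - t * c (lift j i)).
have -> : \sum_(i < n) (d (lift j i) - t * c (lift j i)) *: v (lift j i) =
    \sum_(i < n.+1) (d i - t * c i) *: v i.
  by rewrite [RHS](bigD1_ord j) //= /t divfK // subrr scale0r add0r.
have -> : \sum_(i < n.+1) (d i - t * c i) *: v i =
    \sum_(i < n.+1) d i *: v i - t *: \sum_(i < n.+1) c i *: v i.
  rewrite scaler_sumr -sumrB; apply: eq_bigr => i _.
  by rewrite scalerBl scalerA.
by rewrite opprB addrCA addrC; apply: subspaceD => //; exact: subspaceZ.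
Qed.

Lemma line_sub (v : L) : linear_subspace [set c *: v | c in [set: R[i]]].
Proof.
apply: subspaceP; first by exists 0; rewrite ?scale0r.
move=> c _ _ [d _ <-] [d' _ <-]; exists (c * d + d') => //.
by rewrite scalerDl scalerA.
Qed.

(** Adjoin to W a vector of W' outside W: the sum stays closed by
    [closed_add_line], and its codimension drops. *)
Lemma closed_of_finite_codim W W' : linear_subspace W -> closed W ->
  finite_codim W -> linear_subspace W' -> W `<=` W' -> closed W'.
Proof.
move=> + + [n [v]]; elim: n W v => [|n IH] W v sW cW spv sW' WW'.
  rewrite (_ : W' = W) //; apply/seteqP; split=> // a _.
  by have [c] := spv a; rewrite big_ord0 subr0.
have [W'W|] := pselect (W' `<=` W).
  by rewrite (_ : W' = W) //; apply/seteqP; split.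
move=> /existsNP[x /not_implyP[W'x Wx]].
pose W1 := subspace_add [set c *: x | c in [set: R[i]]] W.
have sW1 : linear_subspace W1 by apply: subspace_add_sub => //; exact: line_sub.
have WW1 : W `<=` W1 by apply: subset_addr; exact: line_sub.
have [c Wc] := spv x.
have [j cj] : exists j, c j != 0.
  apply: contrapT => /forallNP c0; apply: Wx; move: Wc.
  rewrite big1 ?subr0 // => i _.
  by have /negP := c0 i; rewrite negbK => /eqP ->; rewrite scale0r.
have W1c : W1 (\sum_(i < n.+1) c i *: v i).
  exists x; first by exists 1; rewrite ?scale1r.
  by rewrite -opprB; exact: subspaceN.
(* The relation W1c makes v j redundant modulo W1. *)
have spv1 : spans_mod W1 v by move=> a; have [d /WW1] := spv a; exists d.
apply: (IH W1 _ sW1 _ (spans_mod_drop sW1 spv1 W1c cj)) => //.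
  exact: closed_add_line.
move=> a [_ [d _ <-]] Wa; rewrite -(subrK (d *: x) a).
by apply: subspaceD => //; [exact: WW'|exact: subspaceZ].
Qed.

(** A spanning family modulo W can be thinned out to a basis of L / W. *)
Lemma finite_codim_basis W : linear_subspace W -> finite_codim W ->
  exists n (v : 'I_n -> L), spans_mod W v /\ forall c : 'I_n -> R[i],
    W (\sum_(i < n) c i *: v i) -> forall i, c i = 0.
Proof.
move=> sW [n [v]]; elim: n v => [|n IH] v spv.
  by exists 0%N, v; split => // c _ [].
have [|/existsNP[c /not_implyP[Wc /existsNP[j /eqP cj]]]] := pselect (forall c : 'I_n.+1 -> R[i],
    W (\sum_(i < n.+1) c i *: v i) -> forall i, c i = 0); first by exists n.+1, v.
exact: IH (spans_mod_drop sW spv Wc cj).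
Qed.

(** Coordinates on the quotient L / W: a linear surjection p onto row vectors
    with kernel W, and a section s of p. *)
Lemma finite_codim_coordinates W : linear_subspace W -> finite_codim W ->
  exists n (p : L -> 'rV[R[i]]_n) (s : 'rV[R[i]]_n -> L),
    [/\ forall c a b, p (c *: a + b) = c *: p a + p b,
        forall a, W a <-> p a = 0 & forall w, p (s w) = w].
Proof.
move=> sW /(finite_codim_basis sW)[n [v [spv freev]]].
pose s (w : 'rV[R[i]]_n) := \sum_(i < n) w 0 i *: v i.
have sl c w w' : s (c *: w + w') = c *: s w + s w'.
  rewrite /s scaler_sumr -big_split; apply: eq_bigr => i _.
  by rewrite !mxE scalerDl scalerA.
have sinj w : W (s w) -> w = 0.
  by move=> Ww; apply/rowP => i; rewrite mxE; exact: (freev _ Ww).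
have [p pP] : {p : L -> 'rV[R[i]]_n & forall a, W (a - s (p a))}.
  apply: (@choice _ _ (fun a w => W (a - s w))) => a.
  have [c Wc] := spv a; exists (\row_i c i).
  by rewrite /s; under eq_bigr do rewrite mxE.
have puniq a w : W (a - s w) -> p a = w.
  move=> Ww; apply/eqP; rewrite -subr_eq0; apply/eqP; apply: sinj.
  rewrite addrC -scaleN1r sl scaleN1r.
  have -> : - s w + s (p a) = (a - s w) - (a - s (p a)).
    by rewrite opprB [RHS]addrC addrA (subrK a) addrC.
  exact: subspaceB.
exists n, p, s; split=> [c a b|a|w].
- apply: puniq; rewrite sl opprD addrACA -scalerBr.
  exact: (subspaceZD sW).
- split=> [Wa|pa0]; last first.
    have := pP a; rewrite pa0 /s big1 ?subr0 // => i _.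
    by rewrite mxE scale0r.
  by apply: puniq; rewrite /s big1 ?subr0 // => i _; rewrite mxE scale0r.
- by apply: puniq; rewrite subrr; exact: subspace0.
Qed.

(** * Maximal closed subalgebras of finite codimension *)

(** No closedness is required of N: a subspace containing M is closed. *)
Lemma maximal_subalgebra_dichotomy M N : maximal_closed_subalgebra M ->
  finite_codim M -> lie_subalgebra N -> M `<=` N -> N = M \/ N = setT.
Proof.
move=> [[[sM _] cM _] maxM] fM [sN brN] MN.
have [->|NT] := pselect (N = setT); [by right|left].
apply: maxM => //; split => //.
exact: closed_of_finite_codim fM sN MN.
Qed.

(** An ideal J not contained in M satisfies M + J = L. *)
Lemma maximal_subalgebra_add_ideal M J : maximal_closed_subalgebra M ->
  finite_codim M -> lie_ideal J -> ~ J `<=` M ->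
  forall x, exists2 m, M m & J (x - m).
Proof.
move=> maxM fM /lie_idealP[sJ adJ] nJM x.
have [saM _ _] := maxM.1; have sM := saM.1.
have [||E|E] := @maximal_subalgebra_dichotomy M (subspace_add M J) maxM fM.
- split; first exact: subspace_add_sub.
  move=> _ [a [m Mm Ja] [b [m' Mm' Jb] <-]]; exists ⟨m, m'⟩.
    exact: lie_subalgebra_bracket.
  by rewrite lie_bracketBB; apply: subspaceB => //; exact: adJ.
- exact: subset_addl.
- by exfalso; apply: nJM; rewrite -E; exact: subset_addr.
- by have : [set: L] x by []; rewrite -E.
Qed.

(** The ideal K = I `&` J centralizes both I and J. If K is not contained in M,
    then L = M + K, so that modulo K the elements a and b are in I `&` M and
    J `&` M, and [a, b] is the bracket of these representatives. *)
Lemma commutative_ideals_bracket M I J a b : maximal_closed_subalgebra M ->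
  finite_codim M -> lie_ideal I -> lie_ideal J ->
  lie_commutative I -> lie_commutative J -> I a -> J b -> M ⟨a, b⟩.
Proof.
move=> maxM fM /lie_idealP[sI adI] /lie_idealP[sJ adJ] cI cJ Ia Jb.
have [saM _ _] := maxM.1; have sM := saM.1.
have idIJ : lie_ideal (I `&` J).
  apply/lie_idealP; split; first exact: subspaceI.
  by move=> y x [Ix Jx]; split; [exact: adI|exact: adJ].
have [IJM|nIJM] := pselect (I `&` J `<=` M).
  apply: IJM; split; last exact: adJ.
  by rewrite lie_bracketC; apply: subspaceN => //; exact: adI.
have [m Mm [Iam Jam]] := maximal_subalgebra_add_ideal maxM fM idIJ nIJM a.
have [m' Mm' [Ibm Jbm]] := maximal_subalgebra_add_ideal maxM fM idIJ nIJM b.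
suff -> : ⟨a, b⟩ = ⟨m, m'⟩ by exact: lie_subalgebra_bracket.
have : ⟨a - m, b⟩ = 0 by exact: cJ.
have Im : I m by rewrite -(subKr a m); exact: subspaceB.
have : ⟨m, b - m'⟩ = 0 by exact: cI.
by rewrite linearBr linearBl /= => /subr0_eq <- /subr0_eq.
Qed.

(** * Solvable ideals *)

(** D is a chain of ideals with [D_k, D_k] in D_(k+1), and A = D_m is its last
    term not contained in M. Then L = M + A and [A, A] is contained in M, so
    that subspaces between M and L stable under M are subalgebras: M acts
    irreducibly on L / M. The intersection of A with M acts by 0, so that of D_0
    with M acts as a solvable ideal, and thus centrally. *)
Lemma solvable_ideal_acts_trivially M (D : nat -> set L) m :
  maximal_closed_subalgebra M -> finite_codim M ->
  (forall k, lie_ideal (D k)) ->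
  (forall k a b, D k a -> D k b -> D k.+1 ⟨a, b⟩) ->
  ~ D m `<=` M -> D m.+1 `<=` M ->
  forall x y z, M x -> D 0%N x -> M y -> M ⟨⟨x, y⟩, z⟩.
Proof.
move=> maxM fM idD brD nDM DM x y z Mx Dx My.
have [saM _ MT] := maxM.1; have sM := saM.1.
have brM a b : M a -> M b -> M ⟨a, b⟩ by exact: lie_subalgebra_bracket.
have sD k : linear_subspace (D k) by case/lie_idealP: (idD k).
have adD k : ad_stable (D k) by case/lie_idealP: (idD k).
have brDM a b : D m a -> D m b -> M ⟨a, b⟩ by move=> Da Db; apply: DM; exact: brD.
have dec := maximal_subalgebra_add_ideal maxM fM (idD m) nDM.
(* The dimension n of L / M cannot be 0 unless M = L. *)
have [[|n] [p [s [plin pM ps]]]] := finite_codim_coordinates sM fM.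
  by apply/pM/rowP => -[].
have p0 : p 0 = 0 by apply/pM; exact: subspace0.
have pD a b : p (a + b) = p a + p b by have := plin 1 a b; rewrite !scale1r.
have pZ c a : p (c *: a) = c *: p a by have := plin c a 0; rewrite p0 !addr0.
have pB a b : p (a - b) = p a - p b by rewrite -scaleN1r pD pZ scaleN1r.
(* rho a is the matrix of ad a on L / M. It acts on the right, whence the
   reversal in rho_bracket. *)
have [rho rhoP] : {rho : L -> 'M[R[i]]_n.+1 |
    forall a b, M a -> p ⟨a, b⟩ = p b *m rho a}.
  exists (fun a => \matrix_i p ⟨a, s (delta_mx 0 i)⟩) => a b Ma.
  have Mp c d : p c = p d -> p ⟨a, c⟩ = p ⟨a, d⟩.
    move=> pcd; apply/eqP; rewrite -subr_eq0 -pB -linearBr; apply/eqP/pM.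
    by apply: brM => //; apply/pM; rewrite pB pcd subrr.
  have psum (c : 'I_n.+1 -> R[i]) (v : 'I_n.+1 -> L) :
      p (\sum_i c i *: v i) = \sum_i c i *: p (v i).
    elim/big_rec2: _ => [//|i u w _ <-].
    by rewrite pD pZ.
  rewrite mulmx_sum_row (Mp b (\sum_i p b 0 i *: s (delta_mx 0 i))).
    rewrite linear_sumr; under eq_bigr do rewrite linearZr /=.
    by rewrite psum; apply: eq_bigr => i _; rewrite rowK.
  rewrite psum [LHS]row_sum_delta; apply: eq_bigr => i _.
  by rewrite ps.
have rho_bracket a b : M a -> M b -> rho ⟨a, b⟩ = mx_bracket (rho b) (rho a).
  move=> Ma Mb; apply/row_matrixP => i; rewrite !rowE -[delta_mx 0 i]ps.
  set w := s _; rewrite -rhoP; last exact: brM.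
  rewrite /mx_bracket mulmxBr !mulmxA -!rhoP // -pB; congr p.
  by rewrite (lie_jacobi_derivation a) addrK.
have irr : mx_irreducible [set rho a | a in M].
  move=> W [W0 Wlin] stW [w Ww w0].
  have {}W0 : W 0 by rewrite in_setE in W0.
  have {}Wlin c u u' : W u -> W u' -> W (c *: u + u').
    by move=> Wu Wu'; have := Wlin c u u'; rewrite !in_setE; exact.
  pose N : set L := [set a | W (p a)].
  have MN : M `<=` N by move=> a /pM; rewrite /N /= => ->.
  have sN : linear_subspace N.
    apply: subspaceP; first exact: MN (subspace0 sM).
    by move=> c a b Na Nb; rewrite /N /= plin; exact: Wlin.
  have adN a b : M a -> N b -> N ⟨a, b⟩.
    by move=> Ma Nb; rewrite /N /= rhoP //; apply: stW => //; exists a.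
  have saN : lie_subalgebra N.
    split=> // _ [a Na [b Nb <-]].
    have [a' Ma' Daa'] := dec a; have [b' Mb' Dbb'] := dec b.
    have Naa' : N (a - a') by apply: subspaceB => //; exact: MN.
    rewrite -(subrK a' a) linearDl; apply: subspaceD => //; last exact: adN.
    rewrite -(subrK b' b) linearDr; apply: subspaceD => //.
      by apply: MN; exact: brDM.
    by rewrite lie_bracketC; apply: subspaceN => //; exact: adN.
  have [NM|NT] := maximal_subalgebra_dichotomy maxM fM saN MN.
    by move/eqP: w0; case; rewrite -(ps w); apply/pM; rewrite -NM /N /= ps.
  move=> u; have : N (s u) by rewrite NT.
  by rewrite /N /= ps.
have triv a : M a -> D m a -> rho a = 0.
  move=> Ma Da; apply/row_matrixP => i; rewrite rowE row0 -[delta_mx 0 i]ps.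
  rewrite -rhoP //; apply/pM; have [b Mb Db] := dec (s (delta_mx 0 i)).
  rewrite -(subrK b (s _)) linearDr; apply: subspaceD => //; last exact: brM.
  exact: brDM.
apply/pM; rewrite rhoP; last exact: brM.
rewrite rho_bracket // mx_bracketC.
rewrite (irreducible_solvable_ideal
  (J := fun k => [set rho a | a in M `&` D k]) (m := m) irr) ?oppr0 ?mulmx0 //.
- by move=> k _ [a [Ma _] <-]; exists a.
- move=> k _ _ [a [Ma Da] <-] [b Mb <-]; exists ⟨b, a⟩; last exact: rho_bracket.
  by split; [exact: brM|exact: adD].
- move=> k _ _ [a [Ma Da] <-] [b [Mb Db] <-]; exists ⟨b, a⟩; last exact: rho_bracket.
  by split; [exact: brM|exact: brD].
- by move=> _ [a [Ma Da] <-]; exact: triv.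
- by exists x.
- by exists y.
Qed.

(** If D_0 is not contained in M, take A = D_m as above: a bracket of L with D_0
    is congruent modulo A to a bracket of M with D_0 `&` M, which lies in M and
    acts by 0 on L / M. *)
Lemma solvable_ideal_bracket M (D : nat -> set L) n :
  maximal_closed_subalgebra M -> finite_codim M ->
  (forall k, lie_ideal (D k)) -> (forall k, D k.+1 `<=` D k) ->
  (forall k a b, D k a -> D k b -> D k.+1 ⟨a, b⟩) -> D n `<=` [set 0] ->
  forall y x y' x', D 0%N x -> D 0%N x' -> M ⟨⟨y, x⟩, ⟨y', x'⟩⟩.
Proof.
move=> maxM fM idD decrD brD Dn0 y x y' x' Dx Dx'.
have [saM _ _] := maxM.1; have sM := saM.1.
have brM a b : M a -> M b -> M ⟨a, b⟩ by exact: lie_subalgebra_bracket.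
have sD k : linear_subspace (D k) by case/lie_idealP: (idD k).
have adD k : ad_stable (D k) by case/lie_idealP: (idD k).
have DD0 k : D k `<=` D 0%N by elim: k => // k IH a /decrD /IH.
have [D0M|nD0M] := pselect (D 0%N `<=` M).
  by apply/D0M/adD/adD.
have [m nDM DM] : exists2 m, ~ D m `<=` M & D m.+1 `<=` M.
  apply: contrapT => nom; suff /(_ n) : forall k, ~ D k `<=` M.
    by apply=> a /Dn0 ->; exact: subspace0.
  by elim=> // k nDk DkM; apply: nom; exists k.
have dec := maximal_subalgebra_add_ideal maxM fM (idD m) nDM.
have triv := solvable_ideal_acts_trivially maxM fM idD brD nDM DM.
have split_bracket u v : D 0%N v ->
    exists b, [/\ M b, D m (⟨u, v⟩ - b) & forall z, M ⟨b, z⟩].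
  move=> Dv; have [u0 Mu0 Du] := dec u; have [v0 Mv0 Dv0] := dec v.
  have D0v0 : D 0%N v0 by rewrite -(subKr v v0); apply: subspaceB (DD0 m _ Dv0).
  exists ⟨u0, v0⟩; split; first exact: brM.
    by rewrite lie_bracketBB; apply: subspaceB => //; exact: adD.
  by move=> z; rewrite (lie_bracketC u0) linearNl; apply: subspaceN => //; exact: triv.
have [b [Mb Db trivb]] := split_bracket y x Dx.
have [b' [Mb' Db' trivb']] := split_bracket y' x' Dx'.
rewrite -(subrK b ⟨y, x⟩) linearDl; apply: subspaceD => //.
rewrite -(subrK b' ⟨y', x'⟩) linearDr; apply: subspaceD => //.
  by apply: DM; exact: brD.
by rewrite lie_bracketC; apply: subspaceN.
Qed.

(** The derived series without closures; each term is a linear span. *)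
Fixpoint algebraic_derived_series J n : set L :=
  if n is n'.+1 then
    linear_span (lie_commutators (algebraic_derived_series J n')
                                 (algebraic_derived_series J n'))
  else J.

Lemma sub_linear_span A : A `<=` linear_span A.
Proof. by move=> a Aa B [_]; exact. Qed.

Lemma linear_span_min A W : linear_subspace W -> A `<=` W -> linear_span A `<=` W.
Proof. by move=> sW AW a; apply; split. Qed.

(** Each term is an ideal by the derivation rule for brackets. *)
Lemma algebraic_derived_series_ideal J n :
  lie_ideal J -> lie_ideal (algebraic_derived_series J n).
Proof.
move=> idJ; elim: n => [//|n /lie_idealP[sD adD]] /=.
set D := algebraic_derived_series J n in sD adD *.
apply/lie_idealP; split; first exact: linear_span_sub.
move=> y; apply: (@linear_span_min _ [set a | linear_span _ ⟨y, a⟩]).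
  apply: subspaceP; first by rewrite /= linear0r; exact: (subspace0 (linear_span_sub _)).
  move=> c a b Da Db; rewrite /= linearDr linearZr.
  exact: (subspaceZD (linear_span_sub _)).
move=> _ [a Da [b Db <-]]; rewrite /= lie_jacobi_derivation.
apply: (subspaceD (linear_span_sub _)); apply: sub_linear_span.
  by exists ⟨y, a⟩; [exact: adD|exists b].
by exists a => //; exists ⟨y, b⟩ => //; exact: adD.
Qed.

Lemma algebraic_derived_series_decr J n : lie_ideal J ->
  algebraic_derived_series J n.+1 `<=` algebraic_derived_series J n.
Proof.
move=> /(@algebraic_derived_series_ideal J n)/lie_idealP[sD adD] /=.
by apply: linear_span_min => // _ [a _ [b Db <-]]; exact: adD.
Qed.

Lemma algebraic_derived_series_sub J n :
  algebraic_derived_series J n `<=` derived_series J n.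
Proof.
elim: n => [//|n IH] /=; apply: subset_trans (@subset_closure _ _).
apply: linear_span_min; first exact: linear_span_sub.
move=> _ [a Da [b Db <-]]; apply: sub_linear_span.
by exists a; [exact: IH|exists b => //; exact: IH].
Qed.

(** * Largest ideals *)

Lemma solvable_ideal_brackets_commute I y x y' x' : Sem_P_Smax L ->
  lie_ideal I -> lie_solvable I -> I x -> I x' -> ⟨⟨y, x⟩, ⟨y', x'⟩⟩ = 0.
Proof.
move=> hL idI [n In0] Ix Ix'.
suff : P_Smax L ⟨⟨y, x⟩, ⟨y', x'⟩⟩ by rewrite hL.
move=> M [maxM fM].
apply: (solvable_ideal_bracket (D := algebraic_derived_series I) (n := n)
  maxM fM) => //.
- by move=> k; exact: algebraic_derived_series_ideal.
- by move=> k; exact: algebraic_derived_series_decr.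
- by move=> k a b Da Db; apply: sub_linear_span; exists a => //; exists b.
- by rewrite -In0; exact: algebraic_derived_series_sub.
Qed.

(** The commutative ideals commute with one another, so that their union lies in
    a single commutative ideal. *)
Lemma largest_commutative_ideal : Sem_P_Smax L ->
  exists N : set L, largest_ideal lie_commutative N.
Proof.
move=> hL.
pose C := \bigcup_(I in [set I : set L | lie_ideal I /\ lie_commutative I]) I.
have [||N [cN idN comN CN]] := @commuting_ideal_hull C.
- by move=> y a [I [idI cI] Ia]; exists I => //; case/lie_idealP: idI => _; exact.
- move=> a b [I [idI cI] Ia] [J [idJ cJ] Jb].
  suff : P_Smax L ⟨a, b⟩ by rewrite hL.
  by move=> M [maxM fM]; exact: (commutative_ideals_bracket maxM fM idI idJ).
exists N; split=> // I idI cI a Ia.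
by apply: CN; exists I.
Qed.

(** With N the largest commutative ideal, the largest solvable ideal consists of
    the x with [L, x] contained in N. *)
Lemma largest_solvable_ideal : Sem_P_Smax L ->
  exists S : set L, largest_ideal lie_solvable S.
Proof.
move=> hL; have [N [cN idN comN maxN]] := largest_commutative_ideal hL.
have [sN adN] := (lie_idealP N).1 idN.
exists [set x | forall y, N ⟨y, x⟩]; split.
- rewrite (_ : mkset _ = \bigcap_(y in setT) [set x | N ⟨y, x⟩]).
    by apply: closed_bigI => y _; exact: closed_bracket_preimage.
  by apply/seteqP; split=> x Nx y => [_|]; exact: Nx.
- apply/lie_idealP; split; last by move=> y a Na z; apply: adN; exact: Na.
  apply: subspaceP => [y|c a b Na Nb y]; first by rewrite linear0r; exact: subspace0.
  by rewrite linearDr linearZr /=; exact: subspaceZD.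
- (* S_1 is contained in N, which is commutative, so S_2 = 0. *)
  exists 2%N => /=; set S1 := (X in lie_commutators X _).
  have S1N : S1 `<=` N.
    rewrite [X in _ `<=` X](closure_id N).1 //; apply: closureS.
    by apply: linear_span_min => // _ [a _ [b Sb <-]]; exact: Sb.
  have span0 : linear_span (lie_commutators S1 S1) = [set 0].
    apply/seteqP; split; last by move=> _ ->; exact: (subspace0 (linear_span_sub _)).
    apply: linear_span_min.
      by apply: subspaceP => // c a b -> ->; rewrite scaler0 addr0.
    by move=> _ [a Sa [b Sb <-]]; apply: comN; exact: S1N.
  rewrite span0 -(closure_id _).1 //.
  exact/accessible_closed_set1/hausdorff_accessible/norm_hausdorff.
- (* The brackets of L with a solvable ideal I commute, hence lie in N. *)
  move=> I idI solI x Ix y.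
  pose C : set L := [set ⟨y, x⟩ | y in setT & x in I].
  have [sI adI] := (lie_idealP I).1 idI.
  have [||K [_ idK comK CK]] := @commuting_ideal_hull C.
  + by move=> z _ [u _ [v Iv <-]]; exists z => //; exists ⟨u, v⟩ => //; exact: adI.
  + move=> _ _ [u _ [v Iv <-]] [u' _ [v' Iv' <-]].
    exact: (solvable_ideal_brackets_commute _ _ hL idI solI).
  by apply: (maxN K idK comK); apply: CK; exists y => //; exists x.
Qed.

End BanachLie.

Theorem corollary9p11 (R : realType) (L : banachLieType R) (hL : Sem_P_Smax L) :
  (exists J : set L, largest_ideal lie_solvable J) /\
  (exists J : set L, largest_ideal lie_commutative J).
Proof.
by split; [exact: largest_solvable_ideal|exact: largest_commutative_ideal].
Qed.
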